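(* Let $f:L'\to L$ be a covering of Lie--Rinehart $A$-algebras, let $\mathfrak{u}':\mathfrak{uce}_A L'\to L'$ be the canonical map, and put $C:=\mathfrak{uce}_A(f)(\ker\mathfrak{u}')\subseteq \mathfrak{uce}_A L$. (a) Let $h\in \mathrm{Aut}(L)$. There exists $h'\in\mathrm{Aut}(L')$ such that $f h' = h f$ if and only if $\mathfrak{uce}_A(h)(C)=C$. Moreover, in this case $h'$ is uniquely determined by $fh'=hf$, and $h'(\ker f)=\ker f$. (b) The group homomorphism $$\{h\in\mathrm{Aut}(L) : \mathfrak{uce}_A(h)(C)=C\}\to\{g\in\mathrm{Aut}(L') : g(\ker f)=\ker f\}$$ sending $h$ to its lifting $h'$ is a group isomorphism.
   Context: $K$ is a commutative ring with unit, $A$ a unital commutative $K$-algebra, $\mathrm{Der}_K(A)$ the Lie $K$-algebra and $A$-module of $K$-derivations of $A$. A Lie--Rinehart $A$-algebra is a Lie $K$-algebra $L$ with an $A$-module structure and a map (the anchor) $\alpha: L\to \mathrm{Der}_K(A)$ that is both a Lie $K$-algebra and an $A$-module homomorphism, such that $[x,ay]=a[x,y]+x(a)y$ for $x,y\in L$, $a\in A$, where $x(a):=\alpha(x)(a)$. A homomorphism of Lie--Rinehart $A$-algebras is a map that is both a Lie $K$-algebra and an $A$-module homomorphism and commutes with the anchors; $\mathrm{Aut}(L)$ is the group of Lie--Rinehart automorphisms of $L$. $\{L,L\}$ is the $K$-span of the elements $a[x,y]$, $a\in A$, $x,y\in L$; $L$ is perfect if $L=\{L,L\}$. The center is $Z_A(L)=\{x\in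 L : [ax,z]=0 \text{ for all } a\in A, z\in L\}$. A central extension of $L$ is a surjective Lie--Rinehart homomorphism $p:E\to L$ with $\ker p\subseteq Z_A(E)$; it is a covering if $E$ is perfect (then $L$ is perfect too). For a Lie--Rinehart $A$-algebra $L$, let $M_AL$ be the $A$-submodule of $A\otimes_K L\otimes_K L$ ($A$ acting on the first factor) spanned by the elements $a\otimes x\otimes x$; $a\otimes x\otimes y+a\otimes y\otimes x$; $a\otimes x\otimes[y,z]+a\otimes y\otimes[z,x]+a\otimes z\otimes[x,y]$; $a\otimes[x,y]\otimes[x',y']+[x,y](a)\otimes x'\otimes y'-1\otimes[x,y]\otimes a[x',y']$, for $x,x',y,y',z\in L$, $a\in A$. Put $\mathfrak{uce}_A L=(A\otimes_K L\otimes_K L)/M_AL$ and let $(a,x,y)$ be the class of $a\otimes x\otimes y$. It is a Lie--Rinehart $A$-algebra with bracket $[(a,x,y),(a',x',y')]=(aa',[x,y],[x',y'])+(a[x,y](a'),x',y')-([x',y'](a)a',x,y)$ and anchor $(a,x,y)(b)=a[x,y](b)$. The canonical map $\mathfrak{uce}_A L\to L$ is $(a,x,y)\mapsto a[x,y]$. For a Lie--Rinehart homomorphism $f:L\to M$, $\mathfrak{uce}_A(f):\mathfrak{uce}_A L\to\mathfrak{uce}_A M$ is the Lie--Rinehart homomorphism $(a,x,y)\mapsto(a,f(x),f(y))$. *)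

(* Defs.v *)
From HB Require Import structures.
From mathcomp Require Import all_boot all_algebra.
From mathcomp Require Import boolp classical_sets.
From mathcomp Require Import finmap monalg.

Set Implicit Arguments.
Unset Strict Implicit.
Unset Printing Implicit Defensive.

Import GRing.Theory.
Local Open Scope ring_scope.
Local Open Scope classical_set_scope.
Local Open Scope quotient_scope.

Section Span.
Variables (R : pzRingType) (V : lmodType R) (S : set V).

Inductive span : V -> Prop :=
| span0 : span 0
| spanZD c v w of S v & span w : span (c *: v + w).

Lemma span_gen v : S v -> span v.
Proof. by move=> Sv; rewrite -[v]addr0 -[v]scale1r; apply: spanZD Sv span0. Qed.

Lemma spanD v w : span v -> span w -> span (v + w).
Proof.
elim=> [|c u v' Su _ IH] sw; first by rewrite add0r.
by rewrite -addrA; apply: spanZD Su (IH sw).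
Qed.

Lemma spanZ c v : span v -> span (c *: v).
Proof.
elim=> [|d u v' Su _ IH]; first by rewrite scaler0; apply: span0.
by rewrite scalerDr scalerA; apply: spanZD Su IH.
Qed.

Definition span_pred : {pred V} := fun v => `[< span v >].

Lemma span_zmod_closed : zmod_closed span_pred.
Proof.
split=> [|v w /asboolP sv /asboolP sw]; apply/asboolP; first exact: span0.
by apply: spanD => //; rewrite -scaleN1r; apply: spanZ.
Qed.

HB.instance Definition _ := GRing.isZmodClosed.Build V span_pred span_zmod_closed.

Definition lquot : Type := Quotient.quot span_pred.

HB.instance Definition _ := GRing.Zmodule.on lquot.

End Span.

HB.instance Definition _ (R : pzRingType) (V : lmodType R) (S : set V) :=
  GRing.Zmodule.on (lquot S).

(* Locked to keep unification from unfolding the quotient.                    *)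
HB.lock Definition lquot_pi (R : pzRingType) (V : lmodType R) (S : set V)
  (v : V) : lquot S := \pi_(Quotient.quot (span_pred S)) v.
HB.lock Definition lquot_repr (R : pzRingType) (V : lmodType R) (S : set V)
  (q : lquot S) : V := repr (q : Quotient.quot (span_pred S)).

Section Lquot.
Variables (R : pzRingType) (V : lmodType R) (S : set V).

Local Notation span := (span S).
Local Notation lquot := (lquot S).
Local Notation lquot_pi := (lquot_pi S).

Lemma lquot_piD v w : lquot_pi (v + w) = lquot_pi v + lquot_pi w.
Proof. by rewrite lquot_pi.unlock; exact: Quotient.pi_add. Qed.

Lemma lquot_pi_eq v w : lquot_pi v = lquot_pi w <-> span (v - w).
Proof.
rewrite lquot_pi.unlock; split=> [/eqP|s].
  by rewrite -Quotient.idealrBE => /asboolP.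
by apply/eqP; rewrite -Quotient.idealrBE; apply/asboolP.
Qed.

Lemma lquot_reprK q : lquot_pi (lquot_repr q) = q.
Proof. by rewrite lquot_pi.unlock lquot_repr.unlock; exact: reprK. Qed.

Lemma lquot_repr_pi v : span (lquot_repr (lquot_pi v) - v).
Proof. by apply/lquot_pi_eq; rewrite lquot_reprK. Qed.

Definition lquot_scale (c : R) (q : lquot) : lquot := lquot_pi (c *: lquot_repr q).

Lemma lquot_piZ c v : lquot_pi (c *: v) = lquot_scale c (lquot_pi v).
Proof.
apply/esym/lquot_pi_eq; rewrite -scalerBr.
exact: spanZ (lquot_repr_pi v).
Qed.

Fact lquot_scaleA a b q : lquot_scale a (lquot_scale b q) = lquot_scale (a * b) q.
Proof. by rewrite -[q]lquot_reprK -!lquot_piZ scalerA. Qed.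

Fact lquot_scale1 : left_id 1 lquot_scale.
Proof. by move=> q; rewrite -[q]lquot_reprK -lquot_piZ scale1r. Qed.

Fact lquot_scaleDr : right_distributive lquot_scale +%R.
Proof.
move=> a p q; rewrite -[p]lquot_reprK -[q]lquot_reprK.
by rewrite -lquot_piD -!lquot_piZ scalerDr lquot_piD.
Qed.

Fact lquot_scaleDl q : {morph lquot_scale^~ q : a b / a + b}.
Proof.
by move=> a b; rewrite -[q]lquot_reprK -!lquot_piZ scalerDl lquot_piD.
Qed.

HB.instance Definition _ := GRing.Zmodule_isLmodule.Build R lquot
  lquot_scaleA lquot_scale1 lquot_scaleDr lquot_scaleDl.

Lemma lquot_pi_is_linear : linear lquot_pi.
Proof. by move=> c v w; rewrite lquot_piD lquot_piZ. Qed.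

HB.instance Definition _ :=
  GRing.isLinear.Build R V lquot *:%R lquot_pi lquot_pi_is_linear.

Lemma lquot_piB v w : lquot_pi (v - w) = lquot_pi v - lquot_pi w.
Proof. exact: raddfB. Qed.

Lemma lquot_pi0 v : S v -> lquot_pi v = 0.
Proof.
move=> Sv; rewrite -(raddf0 lquot_pi); apply/lquot_pi_eq.
by rewrite subr0; apply: span_gen.
Qed.

Lemma lquot_ind (P : lquot -> Prop) : (forall v, P (lquot_pi v)) -> forall q, P q.
Proof. by move=> PP q; rewrite -[q]lquot_reprK. Qed.

(* The map V / <S> -> W induced by f : V -> W. It is meaningful when f is     *)
(* linear and kills S, see lquot_liftE.                                       *)
Definition lquot_lift (W : Type) (f : V -> W) (q : lquot) : W :=
  f (lquot_repr q).

Variables (W : lmodType R) (f : V -> W).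
Hypotheses (fL : linear f) (fS : forall v, S v -> f v = 0).

Lemma lin0 : f 0 = 0.
Proof. by have := fL (-1) 0 0; rewrite scaleN1r oppr0 addr0 scaleN1r addNr. Qed.

Lemma span_ker v : span v -> f v = 0.
Proof.
by elim=> [|c u w Su _ IH]; rewrite ?lin0 // fL fS // scaler0 add0r.
Qed.

Lemma lquot_liftE v : lquot_lift f (lquot_pi v) = f v.
Proof.
have := span_ker (lquot_repr_pi v).
by rewrite addrC -scaleN1r fL scaleN1r addrC => /eqP; rewrite subr_eq0 => /eqP.
Qed.

Lemma lquot_lift_linear : linear (lquot_lift f).
Proof.
move=> c p q; elim/lquot_ind: p => p; elim/lquot_ind: q => q.
by rewrite -linearP !lquot_liftE; apply: fL.
Qed.

End Lquot.

HB.instance Definition _ (R : pzRingType) (V : lmodType R) (S : set V) :=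
  GRing.Lmodule.on (lquot S).

Section FreeLift.
Variables (K : comNzRingType) (T : choiceType) (W : lmodType K) (b : T -> W).

Definition free_lift (g : {malg K[T]}) : W := \sum_(t <- msupp g) g@_t *: b t.

Lemma free_liftw (g : {malg K[T]}) (D : {fset T}) :
  fsubset (msupp g) D -> free_lift g = \sum_(t <- D) g@_t *: b t.
Proof.
move=> sD; rewrite /free_lift; symmetry.
rewrite (big_fset_incl (+%R) sD) // => t _ /mcoeff_outdom ->.
by rewrite scale0r.
Qed.

Lemma free_lift_linear : linear free_lift.
Proof.
move=> c g h; pose D := fsetU (msupp g) (msupp h).
have sg : fsubset (msupp g) D by apply: fsubsetUl.
have sh : fsubset (msupp h) D by apply: fsubsetUr.
have sgh : fsubset (msupp (c *: g + h)) D.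
  apply: fsubset_trans (msuppD_le _ _) _.
  by rewrite fsetSU // msuppZ_le.
rewrite (free_liftw sg) (free_liftw sh) (free_liftw sgh).
rewrite scaler_sumr -big_split /=; apply: eq_bigr => t _.
by rewrite mcoeffD mcoeffZ scalerDl scalerA.
Qed.

Lemma free_liftU t : free_lift << t >> = b t.
Proof.
rewrite /free_lift msuppU oner_eq0 big_seq_fset1.
by rewrite mcoeffUU scale1r.
Qed.

End FreeLift.

Section Tensor.
Variables (K : comNzRingType) (U V : lmodType K).

Inductive bilinear_rel : set {malg K[(U * V)%type]} :=
| bilinear_rel_l k u u' v :
    bilinear_rel (<< (k *: u + u', v) >> - (k *: << (u, v) >> + << (u', v) >>))
| bilinear_rel_r k u v v' :
    bilinear_rel (<< (u, k *: v + v') >> - (k *: << (u, v) >> + << (u, v') >>)).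

Definition tensor : Type := lquot bilinear_rel.

HB.instance Definition _ := GRing.Lmodule.on tensor.

End Tensor.

HB.instance Definition _ (K : comNzRingType) (U V : lmodType K) :=
  GRing.Lmodule.on (tensor U V).

HB.lock Definition tens (K : comNzRingType) (U V : lmodType K) (u : U) (v : V) :
  tensor U V := lquot_pi (@bilinear_rel K U V) << (u, v) >>.

(* The linear map induced by b : U -> V -> W, meaningful for b bilinear.      *)
HB.lock Definition tensor_lift (K : comNzRingType) (U V W : lmodType K)
    (b : U -> V -> W) : tensor U V -> W :=
  lquot_lift (free_lift (fun p : (U * V)%type => b p.1 p.2)).

Section TensorTheory.
Variables (K : comNzRingType) (U V : lmodType K).

Local Notation tensor := (tensor U V).
Local Notation bilinear_rel := (@bilinear_rel K U V).

Implicit Types (k : K) (u : U) (v : V).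

Lemma tensE u v : tens u v = lquot_pi bilinear_rel << (u, v) >>.
Proof. by rewrite tens.unlock. Qed.

Lemma tens_linl k u u' v : tens (k *: u + u') v = k *: tens u v + tens u' v.
Proof.
rewrite !tensE -linearP; apply/lquot_pi_eq; apply: span_gen.
exact: bilinear_rel_l.
Qed.

Lemma tens_linr k u v v' : tens u (k *: v + v') = k *: tens u v + tens u v'.
Proof.
rewrite !tensE -linearP; apply/lquot_pi_eq; apply: span_gen.
exact: bilinear_rel_r.
Qed.

Lemma tensor_ind (P : tensor -> Prop) :
  P 0 -> (forall k u v t, P t -> P (k *: tens u v + t)) -> forall t, P t.
Proof.
move=> P0 PD; apply: lquot_ind => g.
rewrite [g]monalgE; elim: {1}(enum_fset (msupp g)) => [|p s IH].
  by rewrite big_nil raddf0.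
rewrite big_cons.
have -> : << g@_p *g p >> = g@_p *: << p >> :> {malg K[(U * V)%type]}.
  by apply/malgP => q; rewrite mcoeffZ !mcoeffU mulr_natr.
rewrite linearP; case: p => u v.
by have := PD (g@_(u, v)) u v _ IH; rewrite tensE.
Qed.

Variables (W : lmodType K) (b : U -> V -> W).
Hypotheses (bl : forall v, linear (b^~ v)) (br : forall u, linear (b u)).

Let bS g : bilinear_rel g -> free_lift (fun p => b p.1 p.2) g = 0.
Proof.
have FL := free_lift_linear (fun p : (U * V)%type => b p.1 p.2).
by case=> k u u' v; rewrite addrC -scaleN1r FL FL !free_liftU /= ?bl ?br
  scaleN1r addNr.
Qed.

Lemma tensor_liftE u v : tensor_lift b (tens u v) = b u v.
Proof.
rewrite tensor_lift.unlock tensE lquot_liftE ?free_liftU //.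
exact: free_lift_linear.
Qed.

Lemma tensor_lift_linear : linear (tensor_lift b).
Proof.
rewrite tensor_lift.unlock.
by apply: lquot_lift_linear bS; exact: free_lift_linear.
Qed.

End TensorTheory.

Definition tensor_map (K : comNzRingType) (U U' V V' : lmodType K)
    (f : U -> U') (g : V -> V') : tensor U V -> tensor U' V' :=
  tensor_lift (fun u v => tens (f u) (g v)).

Section TensorMap.
Variables (K : comNzRingType) (U U' V V' : lmodType K).
Variables (f : U -> U') (g : V -> V').
Hypotheses (fL : linear f) (gL : linear g).

Lemma tensor_mapE u v : tensor_map f g (tens u v) = tens (f u) (g v).
Proof.
by apply: tensor_liftE => w k x y; rewrite ?fL ?gL ?tens_linl ?tens_linr.
Qed.

Lemma tensor_map_linear : linear (tensor_map f g).
Proof.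
by apply: tensor_lift_linear => w k x y;
  rewrite ?fL ?gL ?tens_linl ?tens_linr.
Qed.

End TensorMap.

Section Scalars.
Variables (K : comNzRingType) (A : comAlgType K).

Section Res.
Variable V : lmodType A.

Definition resScal : Type := V.

HB.instance Definition _ := GRing.Zmodule.on resScal.

Definition res_scale (k : K) (v : resScal) : resScal := (k%:A : A) *: (v : V).

Fact res_scaleA a b v : res_scale a (res_scale b v) = res_scale (a * b) v.
Proof. by rewrite /res_scale scalerA -scalerAl mul1r scalerA. Qed.

Fact res_scale1 : left_id 1 res_scale.
Proof. by move=> v; rewrite /res_scale !scale1r. Qed.

Fact res_scaleDr : right_distributive res_scale +%R.
Proof. by move=> k u v; rewrite /res_scale scalerDr. Qed.

Fact res_scaleDl v : {morph res_scale^~ v : a b / a + b}.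
Proof. by move=> a b; rewrite /res_scale !scalerDl. Qed.

HB.instance Definition _ := GRing.Zmodule_isLmodule.Build K resScal
  res_scaleA res_scale1 res_scaleDr res_scaleDl.

Lemma res_scaleE k (v : resScal) : k *: v = (k%:A : A) *: (v : V).
Proof. by []. Qed.

End Res.

Section Ext.
Variable V : lmodType K.

(* a . (b (x) v) = ab (x) v *)
Definition tens_act (a : A) : tensor A V -> tensor A V :=
  tensor_map ( *%R a) idfun.

Let mulL (a : A) : linear ( *%R a).
Proof. by move=> k x y; rewrite mulrDr scalerAr. Qed.

Let idL : linear (idfun : V -> V). Proof. by []. Qed.

Lemma tens_act_linear a : linear (tens_act a).
Proof. exact: tensor_map_linear (mulL a) idL. Qed.

Lemma tens_actE a b v : tens_act a (tens b v) = tens (a * b) v.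
Proof. exact: tensor_mapE (mulL a) idL _ _. Qed.

Let tens_act0 a : tens_act a 0 = 0.
Proof. exact: lin0 (tens_act_linear a). Qed.

Let tens_actP a (k : K) b v t :
  tens_act a (k *: tens b v + t) = k *: tens (a * b) v + tens_act a t.
Proof.
apply: etrans (tens_act_linear a k (tens b v) t) _.
by rewrite tens_actE.
Qed.

Fact tens_actA a b t : tens_act a (tens_act b t) = tens_act (a * b) t.
Proof.
elim/tensor_ind: t => [|k c v t IH]; first by rewrite !tens_act0.
by rewrite !tens_actP IH mulrA.
Qed.

Fact tens_act1 : left_id 1 tens_act.
Proof.
elim/tensor_ind => [|k c v t IH]; first by rewrite !tens_act0.
by rewrite !tens_actP IH mul1r.
Qed.

Fact tens_actDr : right_distributive tens_act +%R.
Proof.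
move=> a s t; have := tens_act_linear a 1 s t.
by rewrite scale1r => ->; rewrite scale1r.
Qed.

Fact tens_actDl t : {morph tens_act^~ t : a b / a + b}.
Proof.
move=> a b; elim/tensor_ind: t => [|k c v t IH].
  by rewrite !tens_act0 addr0.
rewrite !tens_actP {}IH.
have -> : tens ((a + b) * c) v = tens (a * c) v + tens (b * c) v.
  by rewrite mulrDl -[a * c]scale1r tens_linl !scale1r.
by rewrite scalerDr [LHS]addrACA.
Qed.

Lemma tens_actk (k : K) t : tens_act k%:A t = k *: t.
Proof.
have tens0 (v : V) : tens (0 : A) v = 0.
  have := tens_linl (-1) (0 : A) 0 v.
  by rewrite scaleN1r oppr0 addr0 scaleN1r addNr.
have tensZ (c : A) (v : V) : tens (k%:A * c) v = k *: tens c v.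
  by rewrite -scalerAl mul1r -[k *: c]addr0 tens_linl tens0 addr0.
elim/tensor_ind: t => [|l c v t IH]; first by rewrite tens_act0 scaler0.
by rewrite tens_actP IH tensZ [RHS]scalerDr [in LHS]scalerA [in RHS]scalerA mulrC.
Qed.

(* A (x)_K V with A acting on the first factor *)
Definition extScal : Type := tensor A V.

HB.instance Definition _ := GRing.Zmodule.on extScal.
HB.instance Definition _ := GRing.Zmodule_isLmodule.Build A extScal
  tens_actA tens_act1 tens_actDr tens_actDl.

Definition ext_tens (a : A) (v : V) : extScal := tens a v.

Lemma ext_tensZ a b v : a *: ext_tens b v = ext_tens (a * b) v.
Proof. exact: tens_actE. Qed.

Lemma ext_tensP a (k : K) u v :
  ext_tens a (k *: u + v) = (k%:A : A) *: ext_tens a u + ext_tens a v.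
Proof.
apply: etrans (tens_linr k a u v) _.
by rewrite -tens_actk.
Qed.

Lemma ext_ind (P : extScal -> Prop) :
  P 0 -> (forall a v t, P t -> P (ext_tens a v + t)) -> forall t, P t.
Proof.
move=> P0 PD; apply: tensor_ind => // k a v t Pt.
have <- : tens (k%:A * a) v = k *: tens a v by rewrite -tens_actE tens_actk.
exact: PD.
Qed.

(* The A-linear map a (x) v |-> a g(v) induced by a K-linear g.               *)
Definition ext_lift (W : lmodType A) (g : V -> resScal W) : extScal -> W :=
  tensor_lift (W := resScal W) (fun (a : A) v => a *: (g v : W)).

Section ExtLift.
Variables (W : lmodType A) (g : V -> resScal W).
Hypothesis gL : linear g.

Let b (a : A) (v : V) : resScal W := a *: (g v : W).

Let bl v : linear (b^~ v).
Proof.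
by move=> k x y; rewrite /b scalerDl res_scaleE scalerA -scalerAl mul1r.
Qed.

Let br a : linear (b a).
Proof.
by move=> k u v; rewrite /b gL scalerDr !res_scaleE !scalerA mulrC.
Qed.

Lemma ext_liftE a v : ext_lift g (ext_tens a v) = a *: (g v : W).
Proof. exact: tensor_liftE bl br _ _. Qed.

Fact ext_liftD s t : ext_lift g (s + t) = ext_lift g s + ext_lift g t.
Proof.
have /(_ 1 s t) := tensor_lift_linear bl br.
by rewrite scale1r => H; apply: etrans H _; rewrite scale1r.
Qed.

Fact ext_lift0 : ext_lift g 0 = 0.
Proof. exact: lin0 (tensor_lift_linear bl br). Qed.

Lemma ext_lift_linear : linear (ext_lift g).
Proof.
move=> a s t; rewrite ext_liftD; congr (_ + _).
elim/ext_ind: s => [|c v s IH]; first by rewrite scaler0 ext_lift0 scaler0.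
have -> : ext_lift g (ext_tens c v + s) = c *: (g v : W) + ext_lift g s.
  by rewrite ext_liftD ext_liftE.
have -> : a *: (ext_tens c v + s) = ext_tens (a * c) v + a *: s.
  by rewrite scalerDr ext_tensZ.
by rewrite ext_liftD ext_liftE IH scalerDr scalerA.
Qed.

End ExtLift.

End Ext.

End Scalars.

HB.instance Definition _ (K : comNzRingType) (A : comAlgType K) (V : lmodType A) :=
  GRing.Lmodule.on (resScal V).
HB.instance Definition _ (K : comNzRingType) (A : comAlgType K) (V : lmodType K) :=
  GRing.Lmodule.on (extScal A V).

Definition is_derivation (K : comNzRingType) (A : comAlgType K) (d : A -> A) :=
  linear d /\ forall a b, d (a * b) = d a * b + a * d b.

(* The K-module structure of L is the one induced by K -> A, k |-> k%:A. The  *)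
(* anchor is uncurried: anchor x is the derivation a |-> x(a). The fields     *)
(* anchor_der, anchor_linear and anchor_lie say that x |-> anchor x is an     *)
(* A-linear Lie homomorphism L -> Der_K(A).                                   *)
HB.mixin Record Lmodule_isLieRinehart (K : comNzRingType) (A : comAlgType K) L
    of GRing.Lmodule A L := {
  lie : L -> L -> L;
  anchor : L -> A -> A;
  lie_linl : forall (k : K) (x y z : L),
    lie (k%:A *: x + y) z = k%:A *: lie x z + lie y z;
  lie_linr : forall (k : K) (x y z : L),
    lie x (k%:A *: y + z) = k%:A *: lie x y + lie x z;
  lie_alt : forall x : L, lie x x = 0;
  lie_jacobi : forall x y z : L,
    lie x (lie y z) + lie y (lie z x) + lie z (lie x y) = 0;
  anchor_der : forall x : L, is_derivation (anchor x);
  anchor_linear : forall (a b : A) (x y : L),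
    anchor (a *: x + y) b = a * anchor x b + anchor y b;
  anchor_lie : forall (x y : L) (a : A),
    anchor (lie x y) a = anchor x (anchor y a) - anchor y (anchor x a);
  lie_leibniz : forall (x y : L) (a : A),
    lie x (a *: y) = a *: lie x y + anchor x a *: y
}.

#[short(type="lieRinehartType")]
HB.structure Definition LieRinehart (K : comNzRingType) (A : comAlgType K) :=
  {L of Lmodule_isLieRinehart K A L & GRing.Lmodule A L}.

HB.mixin Record Linear_isLieRinehartMorphism (K : comNzRingType)
    (A : comAlgType K) (L M : lieRinehartType A) (f : L -> M)
    of @GRing.Linear A L M *:%R f := {
  lr_lie : {morph f : x y / lie x y};
  lr_anchor : forall (x : L) (a : A), anchor (f x) a = anchor x a
}.

HB.structure Definition LieRinehartMorphism (K : comNzRingType)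
    (A : comAlgType K) (L M : lieRinehartType A) :=
  {f of Linear_isLieRinehartMorphism K A L M f & @GRing.Linear A L M *:%R f}.

Notation "{ 'lieRinehart' L -> M }" := (LieRinehartMorphism.type L%type M%type)
  (L at level 98, M at level 99, format "{ 'lieRinehart'  L  ->  M }") : type_scope.

Section Aut.
Variables (K : comNzRingType) (A : comAlgType K).

Section LieRinehartComp.
Variables L M N : lieRinehartType A.

Fact idfun_lr_lie : {morph (@idfun L) : x y / lie x y}. Proof. by []. Qed.
Fact idfun_lr_anchor (x : L) (a : A) : anchor (idfun x) a = anchor x a.
Proof. by []. Qed.
HB.instance Definition _ := Linear_isLieRinehartMorphism.Build K A L L idfun
  idfun_lr_lie idfun_lr_anchor.

Variables (g : {lieRinehart M -> N}) (f : {lieRinehart L -> M}).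

Fact comp_lr_lie : {morph g \o f : x y / lie x y}.
Proof. by move=> x y /=; rewrite !lr_lie. Qed.
Fact comp_lr_anchor (x : L) (a : A) : anchor ((g \o f) x) a = anchor x a.
Proof. by rewrite /= !lr_anchor. Qed.
HB.instance Definition _ := Linear_isLieRinehartMorphism.Build K A L N (g \o f)
  comp_lr_lie comp_lr_anchor.

End LieRinehartComp.

Lemma lr_ext (L M : lieRinehartType A) (f g : {lieRinehart L -> M}) :
  f =1 g -> f = g.
Proof.
case: f g => [f [[[f0 fD]] [fZ] [f1 f2]]] [g [[[g0 gD]] [gZ] [g1 g2]]] /=.
move=> /funext fg; subst g.
rewrite (Prop_irrelevance g0 f0) (Prop_irrelevance gD fD) in g1 g2 *.
rewrite (Prop_irrelevance gZ fZ) in g1 g2 *.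
by rewrite (Prop_irrelevance g1 f1) (Prop_irrelevance g2 f2).
Qed.

Variable L : lieRinehartType A.

(* The inverse of a bijective homomorphism is a homomorphism, see lrAutV.     *)
Record lrAut := LRAut {
  lr_aut :> {lieRinehart L -> L};
  lr_aut_bij : bijective lr_aut
}.

Lemma lrAutP (g h : lrAut) : g =1 h <-> g = h.
Proof.
split=> [|-> //]; case: g h => [g gb] [h hb] /= /lr_ext gh; subst h.
by congr LRAut; exact: Prop_irrelevance.
Qed.

HB.instance Definition _ := gen_eqMixin lrAut.
HB.instance Definition _ := gen_choiceMixin lrAut.

Definition lrAut1 : lrAut := @LRAut idfun (Bijective (frefl _) (frefl _)).

Definition lrAutM (g h : lrAut) : lrAut :=
  @LRAut (g \o h) (bij_comp (lr_aut_bij g) (lr_aut_bij h)).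

Section Inverse.
Variable g : lrAut.

Fact lr_aut_has_inv : exists g' : L -> L, cancel g g' /\ cancel g' g.
Proof. by case: (lr_aut_bij g) => g' gK g'K; exists g'. Qed.

Definition lr_inv : L -> L := projT1 (cid lr_aut_has_inv).

Lemma lr_autK : cancel g lr_inv.
Proof. by rewrite /lr_inv; case: cid => ? []. Qed.

Lemma lr_invK : cancel lr_inv g.
Proof. by rewrite /lr_inv; case: cid => ? []. Qed.

Fact lr_inv_linear : linear lr_inv.
Proof.
move=> a x y; apply: (can_inj lr_autK); rewrite lr_invK [RHS]linearP.
by congr (_ *: _ + _); apply/esym/lr_invK.
Qed.
HB.instance Definition _ :=
  GRing.isLinear.Build A L L *:%R lr_inv lr_inv_linear.

Fact lr_inv_lie : {morph lr_inv : x y / lie x y}.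
Proof. by move=> x y; apply: (can_inj lr_autK); rewrite lr_lie !lr_invK. Qed.
Fact lr_inv_anchor (x : L) (a : A) : anchor (lr_inv x) a = anchor x a.
Proof. by rewrite -[in RHS](lr_invK x) lr_anchor. Qed.
HB.instance Definition _ := Linear_isLieRinehartMorphism.Build K A L L lr_inv
  lr_inv_lie lr_inv_anchor.

Definition lrAutV : lrAut := @LRAut lr_inv (Bijective lr_invK lr_autK).

End Inverse.

Fact lrAutMA : associative lrAutM. Proof. by move=> f g h; apply/lrAutP. Qed.
Fact lrAut1M : left_id lrAut1 lrAutM. Proof. by move=> f; apply/lrAutP. Qed.
Fact lrAutM1 : right_id lrAut1 lrAutM. Proof. by move=> f; apply/lrAutP. Qed.
Fact lrAutVM : left_inverse lrAut1 lrAutV lrAutM.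
Proof. by move=> f; apply/lrAutP => x; apply: lr_autK. Qed.
Fact lrAutMV : right_inverse lrAut1 lrAutV lrAutM.
Proof. by move=> f; apply/lrAutP => x; apply: lr_invK. Qed.

HB.instance Definition _ :=
  isGroup.Build lrAut lrAutMA lrAut1M lrAutM1 lrAutVM lrAutMV.

End Aut.

Section Coverings.
Variables (K : comNzRingType) (A : comAlgType K).

Definition lr_ker (L M : lieRinehartType A) (f : L -> M) : set L :=
  [set x | f x = 0].

(* {L, L}, a K-span *)
Definition lr_derived (L : lieRinehartType A) : set L :=
  @span K (resScal L) [set w | exists a (x y : L), w = a *: lie x y].

Definition lr_perfect (L : lieRinehartType A) : Prop :=
  @lr_derived L = [set: L].

Definition lr_center (L : lieRinehartType A) : set L :=
  [set x | forall (a : A) (z : L), lie (a *: x) z = 0].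

Definition central_extension (E L : lieRinehartType A)
    (p : {lieRinehart E -> L}) : Prop :=
  (forall y, exists x, p x = y) /\ lr_ker p `<=` @lr_center E.

Definition covering (E L : lieRinehartType A) (p : {lieRinehart E -> L}) :=
  central_extension p /\ lr_perfect E.

End Coverings.

Section Uce.
Variables (K : comNzRingType) (A : comAlgType K).

Section Def.
Variable L : lieRinehartType A.

(* A (x)_K L (x)_K L, as an A-module *)
Definition uce_tensor : Type := extScal A (tensor (resScal L) (resScal L)).

HB.instance Definition _ := GRing.Lmodule.on uce_tensor.

Definition tens3 (a : A) (x y : L) : uce_tensor :=
  ext_tens a (tens (x : resScal L) (y : resScal L)).

Inductive uce_rel : set uce_tensor :=
| uce_rel_alt a x : uce_rel (tens3 a x x)
| uce_rel_skew a x y : uce_rel (tens3 a x y + tens3 a y x)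
| uce_rel_jacobi a x y z :
    uce_rel (tens3 a x (lie y z) + tens3 a y (lie z x) + tens3 a z (lie x y))
| uce_rel_anchor a x y x' y' :
    uce_rel (tens3 a (lie x y) (lie x' y')
             + tens3 (anchor (lie x y) a) x' y'
             - tens3 1 (lie x y) (a *: lie x' y')).

(* The quotient of uce_tensor by M_A L, the A-span of uce_rel. Only its       *)
(* A-module structure is set up here.                                         *)
Definition uce : Type := lquot uce_rel.

HB.instance Definition _ := GRing.Lmodule.on uce.

Definition uce_class (a : A) (x y : L) : uce := lquot_pi uce_rel (tens3 a x y).

Lemma uce_ind (P : uce -> Prop) :
  P 0 -> (forall a x y t, P t -> P (uce_class a x y + t)) -> forall t, P t.
Proof.
move=> P0 PD; apply: lquot_ind; apply: ext_ind => [|a w t].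
  by rewrite raddf0.
elim/tensor_ind: w t => [|k x y w IH] t Pt.
  have -> : ext_tens a (0 : tensor (resScal L) (resScal L)) = 0.
    have := tens_linr (-1) a (0 : tensor (resScal L) (resScal L)) 0.
    by rewrite scaleN1r oppr0 addr0 scaleN1r addNr.
  by rewrite add0r.
rewrite ext_tensP ext_tensZ -addrA raddfD; exact: PD (IH _ Pt).
Qed.

Lemma uce_classZ c a x y : c *: uce_class a x y = uce_class (c * a) x y.
Proof.
by rewrite /uce_class -linearZ; congr (lquot_pi _ _); apply: ext_tensZ.
Qed.

Let tens3lx a (k : K) (x x' y : L) :
  tens3 a (k%:A *: x + x') y = (k%:A : A) *: tens3 a x y + tens3 a x' y.
Proof.
apply: etrans (ext_tensP a k _ _); congr (ext_tens a _).
exact: (tens_linl k (x : resScal L) (x' : resScal L) (y : resScal L)).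
Qed.

Let tens3lr a (k : K) (x y y' : L) :
  tens3 a x (k%:A *: y + y') = (k%:A : A) *: tens3 a x y + tens3 a x y'.
Proof.
apply: etrans (ext_tensP a k _ _); congr (ext_tens a _).
exact: (tens_linr k (x : resScal L) (y : resScal L) (y' : resScal L)).
Qed.

Lemma uce_class_linl a (k : K) x x' y :
  uce_class a (k%:A *: x + x') y = (k%:A : A) *: uce_class a x y + uce_class a x' y.
Proof. by rewrite /uce_class tens3lx linearP. Qed.

Lemma uce_class_linr a (k : K) x y y' :
  uce_class a x (k%:A *: y + y') = (k%:A : A) *: uce_class a x y + uce_class a x y'.
Proof. by rewrite /uce_class tens3lr linearP. Qed.

Lemma uce_class_alt a x : uce_class a x x = 0.
Proof. by apply: lquot_pi0; exact: uce_rel_alt. Qed.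

Lemma uce_class_skew a x y : uce_class a x y + uce_class a y x = 0.
Proof. by rewrite -lquot_piD; apply: lquot_pi0; exact: uce_rel_skew. Qed.

Lemma uce_class_jacobi a x y z :
  uce_class a x (lie y z) + uce_class a y (lie z x) + uce_class a z (lie x y) = 0.
Proof. by rewrite -!lquot_piD; apply: lquot_pi0; exact: uce_rel_jacobi. Qed.

Lemma uce_class_anchor a x y x' y' :
  uce_class a (lie x y) (lie x' y') + uce_class (anchor (lie x y) a) x' y'
  - uce_class 1 (lie x y) (a *: lie x' y') = 0.
Proof. by rewrite -lquot_piD -lquot_piB; apply: lquot_pi0; exact: uce_rel_anchor. Qed.

(* The A-linear map (a, x, y) |-> a b(x, y) out of uce_A L. It is meaningful  *)
(* for b satisfying the hypotheses below.                                     *)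
Definition uce_lift (W : lmodType A) (b : L -> L -> W) : uce -> W :=
  lquot_lift (ext_lift (tensor_lift (b : resScal L -> resScal L -> resScal W))).

Section Lift.
Variables (W : lmodType A) (b : L -> L -> W).
Hypotheses
  (b_linl : forall (k : K) x y z, b (k%:A *: x + y) z = k%:A *: b x z + b y z)
  (b_linr : forall (k : K) x y z, b x (k%:A *: y + z) = k%:A *: b x y + b x z)
  (b_alt : forall x, b x x = 0)
  (b_jacobi : forall x y z, b x (lie y z) + b y (lie z x) + b z (lie x y) = 0)
  (b_anchor : forall a x y x' y', a *: b (lie x y) (lie x' y')
     + anchor (lie x y) a *: b x' y' - b (lie x y) (a *: lie x' y') = 0).

Let b' : resScal L -> resScal L -> resScal W := b.
Let b'l z : linear (b'^~ z). Proof. by move=> k x y; exact: b_linl. Qed.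
Let b'r z : linear (b' z). Proof. by move=> k x y; exact: b_linr. Qed.
Let gL : linear (tensor_lift b'). Proof. exact: tensor_lift_linear. Qed.
Let hL : linear (ext_lift (tensor_lift b') : uce_tensor -> W).
Proof. exact: ext_lift_linear. Qed.
Let hE a x y : ext_lift (tensor_lift b') (tens3 a x y) = a *: b x y.
Proof. by rewrite [LHS]ext_liftE // tensor_liftE. Qed.
Let hD s t : ext_lift (tensor_lift b') (s + t : uce_tensor)
  = ext_lift (tensor_lift b') s + ext_lift (tensor_lift b') t.
Proof. by have := hL 1 s t; rewrite !scale1r. Qed.
Let hN s : ext_lift (tensor_lift b') (- s : uce_tensor)
  = - ext_lift (tensor_lift b') s.
Proof.
by have := hL (-1) s 0; rewrite !addr0 !scaleN1r (lin0 hL) addr0.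
Qed.

Let b_skew x y : b x y + b y x = 0.
Proof.
have bDl u v w : b (u + v) w = b u w + b v w.
  by have := b_linl 1 u v w; rewrite !scale1r.
have bDr u v w : b w (u + v) = b w u + b w v.
  by have := b_linr 1 w u v; rewrite !scale1r.
by have := b_alt (x + y); rewrite bDl !bDr !b_alt add0r addr0.
Qed.

Let h_rel t : uce_rel t -> ext_lift (tensor_lift b') t = 0.
Proof.
case=> *; rewrite ?hD ?hN ?hE ?b_alt ?scaler0 -?scalerDr ?b_skew ?b_jacobi
  ?scaler0 // scale1r.
exact: b_anchor.
Qed.

Lemma uce_liftE a x y : uce_lift b (uce_class a x y) = a *: b x y.
Proof. exact: etrans (lquot_liftE hL h_rel _) (hE a x y). Qed.

Lemma uce_lift_linear : linear (uce_lift b).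
Proof. exact: lquot_lift_linear hL h_rel. Qed.

End Lift.

(* (a, x, y) |-> a [x, y], see uce_canE *)
Definition uce_can : uce -> L := uce_lift (@lie K A L).

Let anchorD (a : A) (x y : L) : anchor (x + y) a = anchor x a + anchor y a.
Proof. by have := anchor_linear 1 a x y; rewrite scale1r mul1r. Qed.

Let lie_anchor a (x y x' y' : L) : a *: lie (lie x y) (lie x' y')
     + anchor (lie x y) a *: lie x' y' - lie (lie x y) (a *: lie x' y') = 0.
Proof. by rewrite [lie _ (a *: _)]lie_leibniz subrr. Qed.

Lemma uce_canE a x y : uce_can (uce_class a x y) = a *: lie x y.
Proof.
apply: uce_liftE; [exact: lie_linl|exact: lie_linr|exact: lie_alt|
  exact: lie_jacobi|exact: lie_anchor].
Qed.

Fact uce_can_linear : linear uce_can.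
Proof.
apply: uce_lift_linear; [exact: lie_linl|exact: lie_linr|exact: lie_alt|
  exact: lie_jacobi|exact: lie_anchor].
Qed.

HB.instance Definition _ :=
  GRing.isLinear.Build A uce L *:%R uce_can uce_can_linear.

End Def.

HB.instance Definition _ (L : lieRinehartType A) := GRing.Lmodule.on (uce L).

Section Functor.
Variables (L M : lieRinehartType A) (f : {lieRinehart L -> M}).

(* (a, x, y) |-> (a, f x, f y), see uce_mapE *)
Definition uce_map : uce L -> uce M :=
  uce_lift (fun x y => uce_class 1 (f x) (f y)).

Let fl (k : K) (x y z : L) : uce_class 1 (f (k%:A *: x + y)) (f z)
  = k%:A *: uce_class 1 (f x) (f z) + uce_class 1 (f y) (f z).
Proof. by rewrite linearP uce_class_linl. Qed.
Let fr (k : K) (x y z : L) : uce_class 1 (f x) (f (k%:A *: y + z))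
  = k%:A *: uce_class 1 (f x) (f y) + uce_class 1 (f x) (f z).
Proof. by rewrite linearP uce_class_linr. Qed.
Let fa (x : L) : uce_class 1 (f x) (f x) = 0. Proof. exact: uce_class_alt. Qed.
Let fj (x y z : L) : uce_class 1 (f x) (f (lie y z))
  + uce_class 1 (f y) (f (lie z x)) + uce_class 1 (f z) (f (lie x y)) = 0.
Proof. by rewrite !lr_lie uce_class_jacobi. Qed.
Let fan a (x y x' y' : L) :
  a *: uce_class 1 (f (lie x y)) (f (lie x' y'))
  + anchor (lie x y) a *: uce_class 1 (f x') (f y')
  - uce_class 1 (f (lie x y)) (f (a *: lie x' y')) = 0.
Proof.
rewrite linearZ /= !lr_lie !uce_classZ !mulr1.
have <- : anchor (lie (f x) (f y)) a = anchor (lie x y) a.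
  by rewrite -lr_lie lr_anchor.
exact: uce_class_anchor.
Qed.

Lemma uce_mapE a x y : uce_map (uce_class a x y) = uce_class a (f x) (f y).
Proof.
by rewrite [LHS]uce_liftE ?uce_classZ ?mulr1.
Qed.

Fact uce_map_linear : linear uce_map.
Proof. exact: uce_lift_linear. Qed.

HB.instance Definition _ :=
  GRing.isLinear.Build A (uce L) (uce M) *:%R uce_map uce_map_linear.

End Functor.

Lemma uce_map_ext (L M : lieRinehartType A) (f g : {lieRinehart L -> M}) :
  f =1 g -> uce_map f =1 uce_map g.
Proof. by move=> /lr_ext ->. Qed.

Lemma uce_map_id (L : lieRinehartType A) (t : uce L) : uce_map idfun t = t.
Proof.
elim/uce_ind: t => [|a x y t IH]; first by rewrite raddf0.
by rewrite raddfD /= uce_mapE IH.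
Qed.

Lemma uce_map_comp (L M N : lieRinehartType A) (g : {lieRinehart M -> N})
    (f : {lieRinehart L -> M}) t : uce_map (g \o f) t = uce_map g (uce_map f t).
Proof.
elim/uce_ind: t => [|a x y t IH]; first by rewrite !raddf0.
by rewrite !raddfD /= !uce_mapE IH.
Qed.

End Uce.

Lemma image_stab_group_closed (G : groupType) (T : Type) (act : G -> T -> T)
    (S : set T) :
  act 1%g =1 id -> (forall g h, act (g * h)%g =1 act g \o act h) ->
  group_closed (fun g => `[< act g @` S = S >] : bool).
Proof.
move=> act1 actM.
have a1 : act 1%g @` S = S by rewrite (funext act1) image_id.
have aM g h : act (g * h)%g @` S = act g @` (act h @` S).
  by rewrite (funext (actM g h)) image_comp.
split=> [|g h /asboolP gS /asboolP hS]; apply/asboolP => //.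
by have := aM (g / h)%g h; rewrite mulgVK gS hS.
Qed.

Section Lifting.
Variables (K : comNzRingType) (A : comAlgType K) (L' L : lieRinehartType A).
Variable f : {lieRinehart L' -> L}.

(* C = uce_A(f)(ker u') *)
Definition uce_core : set (uce L) := uce_map f @` [set t | uce_can t = 0].

Definition core_stab : {pred lrAut L} :=
  fun h => `[< uce_map h @` uce_core = uce_core >].

Definition ker_stab : {pred lrAut L'} :=
  fun g => `[< g @` lr_ker f = lr_ker f >].

Fact core_stab_group_closed : group_closed core_stab.
Proof.
apply: (image_stab_group_closed (act := fun h : lrAut L => uce_map h)).
  exact: uce_map_id.
by move=> g h t; apply: uce_map_comp.
Qed.

Fact ker_stab_group_closed : group_closed ker_stab.
Proof. exact: (image_stab_group_closed (act := fun g : lrAut L' => g)). Qed.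

(* {h in Aut(L) | uce_A(h)(C) = C} *)
Record coreAut : predArgType := CoreAut {
  coreAut_val :> lrAut L;
  coreAutP : coreAut_val \in core_stab
}.

HB.instance Definition _ := [isSub for coreAut_val].
HB.instance Definition _ := [Choice of coreAut by <:].
HB.instance Definition _ :=
  SubChoice_isSubGroup.Build (lrAut L) core_stab coreAut core_stab_group_closed.

(* {g in Aut(L') | g(ker f) = ker f} *)
Record kerAut : predArgType := KerAut {
  kerAut_val :> lrAut L';
  kerAutP : kerAut_val \in ker_stab
}.

HB.instance Definition _ := [isSub for kerAut_val].
HB.instance Definition _ := [Choice of kerAut by <:].
HB.instance Definition _ :=
  SubChoice_isSubGroup.Build (lrAut L') ker_stab kerAut ker_stab_group_closed.

End Lifting.

(* Main.v *)
Require Import Defs.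
From HB Require Import structures.
From mathcomp Require Import all_boot all_algebra.
From mathcomp Require Import boolp classical_sets.

(** A covering [f : L' -> L] makes [L'] a quotient of [uce L], and this turns
    the lifting problem along [f] into a question about one submodule.

    Since [ker f] is central, a bracket in [L'] depends only on the images of
    its arguments in [L]; choosing preimages therefore gives a well-defined
    [A]-linear map [s : uce L -> L'], [(a, f x, f y) |-> a [x, y]]
    ([central_uce_section]). It satisfies [s \o uce_map f = uce_can] and
    [f \o s = uce_can]. Perfectness of [L'] makes [uce_can : uce L' -> L']
    surjective, hence so is [s], and its kernel is the image under [uce_map f]
    of [ker uce_can], which is [C = uce_core f] ([covering_uce_quot]). Thus
    [L'] is [uce L / C].

    An automorphism [h] of [L] with [uce_map h @` C = C] consequently induces a
    linear bijection [k] of [L'] with [k \o s = s \o uce_map h]; it covers [h],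
    and then preserves brackets because these are values of [s]
    ([lifts_up]). Conversely, if [h'] lifts [h] then [uce_map h'] preserves the
    kernel of the natural map [uce_can], so [uce_map h] preserves [C]
    ([lifts_core]). Lifts are unique, because [L'] is spanned by multiples of
    brackets and brackets only see images in [L] ([lifts_uniq]).

    Uniqueness makes lifting multiplicative. Its inverse sends an automorphism
    of [L'] preserving [ker f] to the automorphism it induces on
    [L = L' / ker f] ([lifts_down]). *)

Set Implicit Arguments.
Unset Strict Implicit.
Unset Printing Implicit Defensive.

Import GRing.Theory.
Local Open Scope ring_scope.
Local Open Scope classical_set_scope.

(** * Linear maps and brackets *)

(** The factorization through a surjection used twice below: along
    [uce L -> L'] to lift automorphisms, and along [L' -> L] to push them down. *)
Lemma linear_factor (R : pzRingType) (V W X : lmodType R)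
    (p : {linear V -> W}) (g : {linear V -> X}) :
  (forall w, exists v, p v = w) -> (forall v, p v = 0 -> g v = 0) ->
  exists k : {linear W -> X}, forall v, k (p v) = g v.
Proof.
move=> p_surj kerS.
pose s w := projT1 (cid (p_surj w)).
have sK w : p (s w) = w by rewrite /s; case: cid.
have gs v v' : p v = p v' -> g v = g v'.
  move=> pvv; apply/eqP; rewrite -subr_eq0 -raddfB; apply/eqP; apply: kerS.
  by rewrite raddfB /= pvv subrr.
have kL : linear (fun w => g (s w)).
  by move=> c v w; rewrite -linearP; apply: gs; rewrite linearP !sK.
pose k0 := GRing.isLinear.Build R W X *:%R (fun w => g (s w)) kL.
pose k : {linear W -> X} := HB.pack (fun w => g (s w)) k0.
by exists k => v; apply: gs; rewrite sK.
Qed.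

Section LieRinehart.
Variables (K : comNzRingType) (A : comAlgType K).
Implicit Types E L M : lieRinehartType A.

Lemma lieDl L (x y z : L) : lie (x + y) z = lie x z + lie y z.
Proof. by have := lie_linl 1 x y z; rewrite !scale1r. Qed.

Lemma lieDr L (x y z : L) : lie x (y + z) = lie x y + lie x z.
Proof. by have := lie_linr 1 x y z; rewrite !scale1r. Qed.

Lemma lieNC L (x y : L) : lie x y = - lie y x.
Proof.
apply/eqP; rewrite -addr_eq0; have := lie_alt (x + y).
by rewrite lieDl !lieDr !lie_alt add0r addr0 => ->.
Qed.

Section Build.
Variables (L : lieRinehartType A) (k : L -> L).
Hypotheses (k_linear : linear k) (k_lie : {morph k : x y / lie x y})
  (k_anchor : forall x a, anchor (k x) a = anchor x a)
  (k_ker : forall x, k x = 0 -> x = 0) (k_surj : forall y, exists x, k x = y).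

HB.instance Definition _ := GRing.isLinear.Build A L L *:%R k k_linear.
HB.instance Definition _ :=
  Linear_isLieRinehartMorphism.Build K A L L k k_lie k_anchor.

Lemma lrAut_build : exists h : lrAut L, h =1 k.
Proof.
pose r y := projT1 (cid (k_surj y)).
have rK y : k (r y) = y by rewrite /r; case: cid.
have kr x : r (k x) = x.
  apply/eqP; rewrite -subr_eq0; apply/eqP; apply: k_ker.
  by rewrite raddfB /= rK subrr.
have kb : bijective k by exists r.
by exists (LRAut kb).
Qed.

End Build.

(** * The functor [uce] *)

(** Naturality of [uce_can]. *)
Lemma uce_can_map L M (f : {lieRinehart L -> M}) t :
  uce_can (uce_map f t) = f (uce_can t).
Proof.
elim/uce_ind: t => [|a x y t IH]; first by rewrite !raddf0.
by rewrite !raddfD /= uce_mapE !uce_canE linearZ /= lr_lie IH.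
Qed.

Lemma uce_map_autK L (h : lrAut L) : cancel (uce_map h) (uce_map (lrAutV h)).
Proof.
move=> t; rewrite -uce_map_comp -[RHS]uce_map_id.
by apply: uce_map_ext => x; apply: lr_autK.
Qed.

Lemma uce_map_invK L (h : lrAut L) : cancel (uce_map (lrAutV h)) (uce_map h).
Proof.
move=> t; rewrite -uce_map_comp -[RHS]uce_map_id.
by apply: uce_map_ext => x; apply: lr_invK.
Qed.

Lemma uce_map_surj L M (f : {lieRinehart L -> M}) :
  (forall y, exists x, f x = y) -> forall t, exists t', uce_map f t' = t.
Proof.
move=> fs; elim/uce_ind => [|a y z t [t' <-]].
  by exists 0; rewrite raddf0.
have [[x <-] [x' <-]] := (fs y, fs z).
by exists (uce_class a x x' + t'); rewrite raddfD /= uce_mapE.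
Qed.

Lemma uce_can_surj L : lr_perfect L -> forall x, exists t : uce L, uce_can t = x.
Proof.
move=> Lp x; have: lr_derived x by rewrite Lp.
elim=> [|k _ w [a [y [z ->]]] _ [t <-]]; first by exists 0; rewrite raddf0.
exists (k%:A *: uce_class a y z + t).
by rewrite linearP /= uce_canE.
Qed.

(** * Central extensions *)

Section Central.
Variables (E L : lieRinehartType A) (p : {lieRinehart E -> L}).
Hypothesis p_central : central_extension p.

(** Two preimages differ by a central element, so the bracket of [E] factors
    through [L * L]. *)
Lemma central_lie (x x' y y' : E) :
  p x = p x' -> p y = p y' -> lie x y = lie x' y'.
Proof.
have cl u v w : p u = p v -> lie u w = lie v w.
  move=> puv; rewrite -(subrK v u) lieDl.
  have /(p_central.2) /(_ 1 w) : lr_ker p (u - v).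
    by rewrite /lr_ker /= raddfB /= puv subrr.
  by rewrite scale1r => ->; rewrite add0r.
by move=> /cl -> /cl pyy'; rewrite lieNC pyy' -lieNC.
Qed.

(** On [a [y, z]] a homomorphism [g] takes the value [a [g y, g z]], which by
    [central_lie] is determined by [p \o g]; perfectness of [M] says that such
    elements span. *)
Lemma central_lift_uniq M (g g' : {lieRinehart M -> E}) :
  lr_perfect M -> (forall x, p (g x) = p (g' x)) -> g =1 g'.
Proof.
move=> Mp pg x; have [t <-] := uce_can_surj Mp x.
elim/uce_ind: t => [|a y z t IH]; first by rewrite !raddf0.
rewrite !raddfD /= uce_canE !linearZ /= !lr_lie IH.
by rewrite (central_lie (x' := g' y) (y' := g' z)).
Qed.

(** The defining relations of [uce L] hold for brackets of chosen preimages: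
    by [central_lie] the preimage of a sum, multiple or bracket may be replaced
    by the sum, multiple or bracket of preimages, after which they are the axioms
    of [E]. *)
Lemma central_uce_section :
  exists s : {linear uce L -> E}, forall a x y,
    s (uce_class a (p x) (p y)) = a *: lie x y.
Proof.
pose r y := projT1 (cid (p_central.1 y)).
have rK y : p (r y) = y by rewrite /r; case: cid.
pose b x y := lie (r x) (r y).
have bE x y : b (p x) (p y) = lie x y by apply: central_lie; rewrite rK.
have bl (k : K) x y z : b (k%:A *: x + y) z = k%:A *: b x z + b y z.
  by rewrite -lie_linl; apply: central_lie => //; rewrite rK linearP /= !rK.
have br (k : K) x y z : b x (k%:A *: y + z) = k%:A *: b x y + b x z.
  by rewrite -lie_linr; apply: central_lie => //; rewrite rK linearP /= !rK.
have ba x : b x x = 0 by exact: lie_alt.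
have blie x y z : b x (lie y z) = lie (r x) (lie (r y) (r z)).
  by apply: central_lie => //; rewrite rK lr_lie !rK.
have bj x y z : b x (lie y z) + b y (lie z x) + b z (lie x y) = 0.
  by rewrite !blie lie_jacobi.
have ban (a : A) x y x' y' : a *: b (lie x y) (lie x' y')
     + anchor (lie x y) a *: b x' y' - b (lie x y) (a *: lie x' y') = 0.
  have -> : b (lie x y) (a *: lie x' y')
      = lie (r (lie x y)) (a *: lie (r x') (r y')).
    by apply: central_lie => //; rewrite rK linearZ /= lr_lie !rK.
  (* The Leibniz term of [E] has the anchor of a preimage of [lie x y], which
     is that of [lie x y] itself as [p] preserves anchors. *)
  rewrite lie_leibniz blie.
  by rewrite -[in anchor (r _) a](lr_anchor (s := p)) rK subrr.
pose s0 := GRing.isLinear.Build A (uce L) E *:%R (uce_lift b)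
  (uce_lift_linear bl br ba bj ban).
pose s : {linear uce L -> E} := HB.pack (uce_lift b) s0.
by exists s => a x y; rewrite /s /= uce_liftE // bE.
Qed.

End Central.

(** * Lifting automorphisms along a covering *)

Section Lifting.
Variables (L' L : lieRinehartType A) (f : {lieRinehart L' -> L}).

Definition lifts (h : lrAut L) (h' : lrAut L') := forall x, f (h' x) = h (f x).

Lemma liftsM h1 h2 h1' h2' :
  lifts h1 h1' -> lifts h2 h2' -> lifts (h1 * h2)%g (h1' * h2')%g.
Proof. by move=> l1 l2 x; rewrite [LHS]l1 /= l2. Qed.

Lemma liftsV h h' : lifts h h' -> lifts (lrAutV h) (lrAutV h').
Proof.
by move=> l x; rewrite -[in RHS](lr_invK h' x) l [RHS]lr_autK.
Qed.

Lemma lifts_ker h h' : lifts h h' -> h' @` lr_ker f = lr_ker f.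
Proof.
move=> l; apply/seteqP; split=> [_ [x fx <-]|x fx].
  by rewrite /lr_ker /= l fx raddf0.
exists (lrAutV h' x); last exact: lr_invK.
by rewrite /lr_ker /= (liftsV l) fx raddf0.
Qed.

(** If [t] lies in [ker uce_can], so does [uce_map h' t] by naturality, whence
    one inclusion; the other is the same inclusion for the inverses. *)
Lemma lifts_core h h' : lifts h h' -> uce_map h @` uce_core f = uce_core f.
Proof.
have sub k k' : lifts k k' -> uce_map k @` uce_core f `<=` uce_core f.
  move=> l _ [_ [t /= t0 <-] <-]; exists (uce_map k' t) => /=.
    by rewrite uce_can_map t0 raddf0.
  by rewrite -!uce_map_comp; apply: uce_map_ext => x; apply: l.
move=> l; apply/seteqP; split=> [|t Ct]; first exact: sub l.
exists (uce_map (lrAutV h) t).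
  by apply: (sub _ _ (liftsV l)); exists t.
exact: uce_map_invK.
Qed.

(** [g] induces a map on [L = L' / ker f], injective because [g] maps [ker f]
    onto itself; it respects brackets and anchors since [f] is surjective and
    preserves both. *)
Lemma lifts_down (g : lrAut L') : (forall y, exists x, f x = y) ->
  g @` lr_ker f = lr_ker f -> exists h, lifts h g.
Proof.
move=> fs gker.
have [|k kE] := linear_factor (g := f \o g) fs.
  move=> x fx /=; suff: lr_ker f (g x) by [].
  by rewrite -gker; exists x.
have ks y : exists x, k x = y.
  have [x <-] := fs y; exists (f (lrAutV g x)).
  by rewrite kE /= [g _]lr_invK.
have k0 y : k y = 0 -> y = 0.
  have [x <-] := fs y; rewrite kE /= => gx.
  have: lr_ker f (g x) by [].
  rewrite -gker => -[z fz /(can_inj (lr_autK g)) <-]; exact: fz.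
have kl : {morph k : x y / lie x y}.
  move=> y z; have [[x <-] [x' <-]] := (fs y, fs z).
  by rewrite -lr_lie !kE /= !lr_lie.
have ka y a : anchor (k y) a = anchor y a.
  by have [x <-] := fs y; rewrite kE /= !lr_anchor.
have [h hE] := lrAut_build (linearP k) kl ka k0 ks.
by exists h => x; rewrite hE kE.
Qed.

Hypothesis f_covering : covering f.

Let f_central : central_extension f := f_covering.1.
Let f_surj : forall y, exists x, f x = y := f_covering.1.1.
Let L'_perfect : lr_perfect L' := f_covering.2.

(** [L'] is the quotient of [uce L] by [uce_core f], with [f] induced by
    [uce_can]. *)
Lemma covering_uce_quot : exists s : {linear uce L -> L'},
  [/\ forall x y, s (uce_class 1 (f x) (f y)) = lie x y,
      forall t, f (s t) = uce_can t,
      forall t, s t = 0 <-> uce_core f t & forall x, exists t, s t = x].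
Proof.
have [s sE] := central_uce_section f_central.
have suce t : s (uce_map f t) = uce_can t.
  elim/uce_ind: t => [|a x y t IH]; first by rewrite !raddf0.
  by rewrite !raddfD /= uce_mapE sE uce_canE IH.
have mapP := uce_map_surj f_surj.
exists s; split=> [x y|t|t|x].
- by rewrite sE scale1r.
- by have [t' <-] := mapP t; rewrite suce uce_can_map.
- split=> [|[t' t'0 <-]]; last by rewrite suce.
  by have [t' <-] := mapP t; rewrite suce; exists t'.
- by have [t <-] := uce_can_surj L'_perfect x; exists (uce_map f t).
Qed.

(** As [uce_map h] preserves the kernel of [s], it induces a linear bijection
    [k] of [L']. *)
Lemma lifts_up (h : lrAut L) :
  uce_map h @` uce_core f = uce_core f -> exists h', lifts h h'.
Proof.
move=> hC; have [s [s_lie fs s_ker s_surj]] := covering_uce_quot.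
have [|k kE] := linear_factor (p := s) (g := s \o uce_map h) s_surj.
  by move=> t /s_ker Ct /=; apply/s_ker; rewrite -hC; exists t.
have fk x : f (k x) = h (f x).
  by have [t <-] := s_surj x; rewrite kE /= !fs uce_can_map.
(* [lie x y = s (1, f x, f y)] is mapped to [s (1, h (f x), h (f y))], where
   [h (f x) = f (k x)], and this is [lie (k x) (k y)]. *)
have kl : {morph k : x y / lie x y}.
  by move=> x y; rewrite -s_lie kE /= uce_mapE -!fk s_lie.
have ka x a : anchor (k x) a = anchor x a.
  by rewrite -(lr_anchor (s := f)) fk !lr_anchor.
have k0 x : k x = 0 -> x = 0.
  have [t <-] := s_surj x; rewrite kE /= => /s_ker.
  by rewrite -hC => -[t' Ct' /(can_inj (uce_map_autK h)) <-]; apply/s_ker.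
have ks x : exists y, k y = x.
  have [t <-] := s_surj x; exists (s (uce_map (lrAutV h) t)).
  by rewrite kE /= uce_map_invK.
have [h' h'E] := lrAut_build (linearP k) kl ka k0 ks.
by exists h' => x; rewrite h'E fk.
Qed.

Lemma lifts_uniq h h' h'' : lifts h h' -> lifts h h'' -> h'' = h'.
Proof.
move=> l' l''; apply/lrAutP.
by apply: (central_lift_uniq f_central) => // x; rewrite l' l''.
Qed.

End Lifting.
End LieRinehart.

Theorem theorem4p1 (K : comNzRingType) (A : comAlgType K)
    (L' L : lieRinehartType A) (f : {lieRinehart L' -> L})
    (f_covering : covering f) :
  (forall h : lrAut L,
    ((exists h' : lrAut L', forall x : L', f (h' x) = h (f x))
      <-> uce_map h @` uce_core f = uce_core f)
    /\ (forall h' : lrAut L', (forall x : L', f (h' x) = h (f x)) ->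
         (forall h'' : lrAut L', (forall x : L', f (h'' x) = h (f x)) ->
            h'' = h')
         /\ h' @` lr_ker f = lr_ker f))
  /\ (exists lift : {multiplicative coreAut f -> kerAut f},
        (forall (h : coreAut f) (x : L'), f (lift h x) = h (f x))
        /\ bijective lift).
Proof.
have uniq := lifts_uniq f_covering.
have f_surj := f_covering.1.1.
split=> [h|].
  split; first split=> [[h' l]|]; [exact: lifts_core l|exact: lifts_up|].
  by move=> h' l; split=> [h''|]; [exact: uniq|exact: lifts_ker l].
have up (h : coreAut f) : exists h' : kerAut f, lifts f h h'.
  have [h' l] := lifts_up f_covering (asboolW (coreAutP h)).
  by exists (KerAut (asboolT (lifts_ker l))).
have down (g : kerAut f) : exists h : coreAut f, lifts f h g.
  have [h l] := lifts_down f_surj (asboolW (kerAutP g)).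
  by exists (CoreAut (asboolT (lifts_core l))).
pose lift h := projT1 (cid (up h)).
have liftP (h : coreAut f) : lifts f h (lift h) by rewrite /lift; case: cid.
pose unlift g := projT1 (cid (down g)).
have unliftP (g : kerAut f) : lifts f (unlift g) g by rewrite /unlift; case: cid.
have liftM : {morph lift : h1 h2 / (h1 * h2)%g}.
  move=> h1 h2; apply: val_inj; apply: uniq (liftP _).
  exact: (liftsM (liftP h1) (liftP h2)).
pose m0 := isMultiplicative.Build _ _ lift liftM.
pose m : {multiplicative coreAut f -> kerAut f} := HB.pack lift m0.
exists m; split=> //; exists unlift => [h|g]; last first.
  by apply: val_inj; apply: uniq (liftP _).
apply: val_inj; apply/lrAutP => y; have [x <-] := f_surj y.
by rewrite -(unliftP (lift h)) liftP.
Qed.
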